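(* Let $n\in\mathbb{Z}_{\ge0}$. The values of $\mathcal{K}_n(s;n)$ for $s=0,1,2,\ldots,n$ are $$\mathcal{K}_n(s;n)=\begin{cases}1 & \text{if } s=0,2,4,\ldots,n_{\mathrm{even}},\\ -1 & \text{if } s=1,3,5,\ldots,n_{\mathrm{odd}},\end{cases}$$ where $n_{\mathrm{odd}}=n$ and $n_{\mathrm{even}}=n-1$ if $n$ is odd, and $n_{\mathrm{odd}}=n-1$ and $n_{\mathrm{even}}=n$ if $n$ is even.
   Context: Krawtchouk polynomials: $\mathcal{K}_k(x;y)=\sum_{j=0}^k(-1)^j\binom{x}{j}\binom{y-x}{k-j}$ for $k\in\mathbb{Z}_{\ge0}$, where $\binom{u}{m}=\frac{u(u-1)\cdots(u-m+1)}{m!}$ for $m\ge1$ and $\binom u0=1$. *)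

(* Defs.v *)
From mathcomp Require Import all_boot all_order all_algebra.
Set Implicit Arguments. Unset Strict Implicit. Unset Printing Implicit Defensive.
Import Order.TTheory GRing.Theory Num.Theory.
Local Open Scope ring_scope.

(* The upper argument [u] is an arbitrary scalar, unlike in 'C(n, m).  The
   empty product gives [gbinom u 0 = 1]. *)
Definition gbinom (F : numFieldType) (u : F) (m : nat) : F :=
  (\prod_(i < m) (u - i%:R)) / (m`!)%:R.

Definition krawtchouk (F : numFieldType) (k : nat) (x y : F) : F :=
  \sum_(j < k.+1) (-1) ^+ j * gbinom x j * gbinom (y - x) (k - j).

Definition n_even (n : nat) : nat := if odd n then n.-1 else n.

(* For n = 0 the value n - 1 = -1 is truncated to 0; no odd number lies below
   either bound, so the range 1, 3, ..., n_odd is empty in both readings. *)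
Definition n_odd (n : nat) : nat := if odd n then n else n.-1.

(* Main.v *)
Require Import Defs.
From mathcomp Require Import all_boot all_order all_algebra.
Set Implicit Arguments. Unset Strict Implicit. Unset Printing Implicit Defensive.
Import Order.TTheory GRing.Theory Num.Theory.
Local Open Scope ring_scope.

(** At integer arguments [s <= n] the Krawtchouk sum of degree [n] runs over the
    products of ['C(s, j)] and ['C(n - s, n - j)].  The first factor vanishes
    when [j > s] and the second when [j < s], so only the term [j = s] survives,
    and it equals [(-1) ^+ s].  That the generalized binomials are the usual
    ones at natural arguments is [gbinom_nat]; the collapse of the sum is
    [krawtchouk_diag]. *)

Lemma prod_natr_ffact (R : pzRingType) (s m : nat) :
  \prod_(i < m) (s%:R - i%:R) = (s ^_ m)%:R :> R.
Proof.
elim: m => [|m IHm]; first by rewrite big_ord0 ffactn0.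
rewrite big_ord_recr /= IHm ffactnSr natrM.
(* [s - m] is truncated in [nat]; when it is, [s ^_ m] is already zero. *)
have [le_ms | lt_sm] := leqP m s; first by rewrite natrB.
by rewrite ffact_small // !mul0r.
Qed.

Lemma gbinom_nat (F : numFieldType) (s m : nat) :
  gbinom (s%:R : F) m = 'C(s, m)%:R.
Proof.
rewrite /gbinom prod_natr_ffact -bin_ffact natrM mulfK //.
by rewrite pnatr_eq0 -lt0n fact_gt0.
Qed.

Lemma krawtchouk_diag (F : numFieldType) (n s : nat) :
  (s <= n)%N -> krawtchouk n (s%:R : F) n%:R = (-1) ^+ s.
Proof.
move=> le_sn; have lt_sn1 : (s < n.+1)%N by [].
rewrite /krawtchouk -natrB // (bigD1 (Ordinal lt_sn1)) //= big1 => [|j neq_js].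
  by rewrite !gbinom_nat !binn !mulr1 addr0.
rewrite !gbinom_nat.
case: (ltngtP j s) => [lt_js | lt_sj | eq_js].
- by rewrite (bin_small (ltn_sub2l (leq_trans lt_js le_sn) lt_js)) mulr0.
- by rewrite (bin_small lt_sj) mulr0 mul0r.
- by case/eqP: neq_js; apply: val_inj.
Qed.

Theorem corollary1p33 (F : numFieldType) (n s : nat) (hs : (s <= n)%N) :
  [/\ ~~ odd s, (s <= n_even n)%N & krawtchouk n (s%:R : F) (n%:R : F) = 1]
  \/ [/\ odd s, (s <= n_odd n)%N & krawtchouk n (s%:R : F) (n%:R : F) = -1].
Proof.
rewrite krawtchouk_diag // -signr_odd /n_even /n_odd.
(* When [s] and [n] have opposite parities, [s <= n] improves to [s <= n.-1]. *)
have le_pred : odd s != odd n -> (s <= n.-1)%N.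
  move=> neq_odd; have lt_sn : (s < n)%N.
    by rewrite ltn_neqAle hs andbT; apply: contraNneq neq_odd => ->.
  by rewrite -ltnS (ltn_predK lt_sn).
case: (odd s) le_pred => le_pred; [right | left]; split=> //.
- by case: (odd n) le_pred => // ->.
- by case: (odd n) le_pred => // ->.
Qed.
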